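(* Let $q$ be a prime power, $n\ge1$, let $A_B\in\mathbb{F}_q^{n\times n}$ be invertible, and let $A_E\in\mathbb{F}_q^{m_E\times n}$ with $\operatorname{rank}(A_E)=r_E\le m_E<n$. Put $C_s=(n-r_E)\log q$. Consider any sequence of codes, indexed by the blocklength $N$, of rate $R>C_s$ for the memoryless noiseless wiretap channel with input $X\in\mathbb{F}_q^n$, Bob's output $Y_B=A_BX$ and Eve's output $Y_E=A_EX$; let $P_e^{(N)}$ be Bob's error probability. Then: 1. If $P_e^{(N)}\to0$, then $\displaystyle\liminf_{N\to\infty}\frac{I(M;Y_E^N)}{N}\ge R-C_s>0$. 2. If $I(M;Y_E^N)/N\to0$, then $\displaystyle\liminf_{N\to\infty}P_e^{(N)}\ge1-\frac{C_s}{R}>0$.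
   Context: A blocklength-$N$ code of rate $R$ consists of a message $M$ uniform on a set of $\lfloor\exp(NR)\rfloor$ elements ($\exp$ being taken in the base of $\log$), a possibly randomized encoder mapping $M$ to $X^N=(X_1,\dots,X_N)\in(\mathbb{F}_q^n)^N$, and a decoder mapping $Y_B^N=(A_BX_1,\dots,A_BX_N)$ to an estimate $\hat M$ of $M$; $P_e^{(N)}=\Pr[\hat M\ne M]$. Eve observes $Y_E^N=(A_EX_1,\dots,A_EX_N)$. All entropies, mutual informations and rates use the same fixed base of $\log$. *)

(* Defs.v *)
From HB Require Import structures.
From mathcomp Require Import all_boot all_order all_algebra.
From mathcomp Require Import all_classical all_reals all_analysis.

Set Implicit Arguments.
Unset Strict Implicit.
Unset Printing Implicit Defensive.

Import Order.TTheory GRing.Theory Num.Theory.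
Import numFieldNormedType.Exports.

Local Open Scope ring_scope.

Definition logb (R : realType) (b x : R) : R := ln x / ln b.

Section FiniteProbability.
Variables (R : realType) (T : finType).
Implicit Type p : T -> R.

Definition pr p (E : pred T) : R := \sum_(t | E t) p t.

Definition is_distribution p := (forall t, 0 <= p t) /\ \sum_t p t = 1.

(* I(U; V) in base b for random variables U, V on the finite space (T, p).
   The convention 0 log 0 = 0 holds because of the leading factor. *)
Definition mutual_info (b : R) p (A B : finType) (U : T -> A) (V : T -> B) : R :=
  \sum_(u : A) \sum_(v : B)
    let puv := pr p [pred t | (U t == u) && (V t == v)] in
    puv * logb b (puv / (pr p [pred t | U t == u] * pr p [pred t | V t == v])).

End FiniteProbability.

(* (F^n)^N *)
Notation block F n N := {ffun 'I_N -> 'cV[F]_n}.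

Definition channel_output (F : finFieldType) (m n N : nat) (A : 'M[F]_(m, n))
    (x : block F n N) : block F m N :=
  [ffun i => A *m x i].

(* Codes with K messages and blocklength N. [encoder c w x] is the conditional
   probability that the (randomized) encoder emits x given the message w. *)
Record wiretap_code (R : realType) (F : finFieldType) (n K N : nat) :=
  WiretapCode {
    encoder : 'I_K -> block F n N -> R;
    encoder_distribution : forall w, is_distribution (encoder w);
    decoder : block F n N -> 'I_K
  }.

(* floor (b ^ (N * rate)); the argument of truncn is nonnegative. *)
Definition message_count (R : realType) (b rate : R) (N : nat) : nat :=
  Num.truncn (b `^ (N%:R * rate)).

Section Code.
Variables (R : realType) (F : finFieldType) (n K N : nat).
Variable c : wiretap_code R F n K N.

(* Joint law of (M, X^N), with M uniform. *)
Definition joint_law (t : 'I_K * block F n N) : R :=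
  K%:R^-1 * encoder c t.1 t.2.

Definition error_prob (AB : 'M[F]_n) : R :=
  pr joint_law [pred t | decoder c (channel_output AB t.2) != t.1].

Definition leakage (b : R) (mE : nat) (AE : 'M[F]_(mE, n)) : R :=
  mutual_info b joint_law
    (fun t => t.1) (fun t => channel_output AE t.2).

End Code.

(* Main.v *)
(* Given Eve's output, the input block lies in one of at most
   L = q^((n - rE) N) positions (a coset of ker AE in each coordinate), so the
   estimate of M that Bob computes from it takes at most L values. Guessing M
   uniformly on that list with probability 1/2, and uniformly on all K messages
   otherwise, Gibbs' inequality gives the one-shot converse
     I(M; Y_E^N) >= (1 - P_e) (log K - N C_s) - log 2.
   Dividing by N yields part 1; in part 2 it even forces P_e --> 1, and
   1 >= 1 - C_s / R. *)
Require Import Defs.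
From HB Require Import structures.
From mathcomp Require Import all_boot all_order all_algebra.
From mathcomp Require Import all_classical all_reals all_analysis.
From mathcomp Require Import mxabelem ring lra.

Set Implicit Arguments.
Unset Strict Implicit.
Unset Printing Implicit Defensive.

Import Order.TTheory GRing.Theory Num.Theory.
Import numFieldNormedType.Exports.

Local Open Scope classical_set_scope.
Local Open Scope ring_scope.

(** * Finite probability, Gibbs' inequality and list decoding *)

Section FiniteProbabilityTheory.
Variables (R : realType) (T : finType) (p : T -> R).
Hypothesis p_ge0 : forall t, 0 <= p t.

Lemma pr_ge0 (E : pred T) : 0 <= pr p E.
Proof. by apply: sumr_ge0. Qed.

Lemma pr_le (E E' : pred T) : (forall t, E t -> E' t) -> pr p E <= pr p E'.
Proof.
move=> sub; rewrite /pr [leLHS]big_mkcond [leRHS]big_mkcond.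
apply: ler_sum => t _; case: ifP => [/sub -> //|_].
by case: ifP.
Qed.

(** Grouping outcomes by the value of [U]. With [E] the event [V t == v] this sums out one variable
    of a joint law; with [E] always true it sums a marginal law. *)
Lemma sum_pr (A : finType) (U : T -> A) (E : pred T) (G : A -> R) :
  \sum_u pr p [pred t | (U t == u) && E t] * G u = \sum_(t | E t) p t * G (U t).
Proof.
under eq_bigr do rewrite /pr mulr_suml.
rewrite (exchange_big_dep E) /= => [|u t _ /andP[] //].
apply: eq_bigr => t Et; under eq_bigl do rewrite Et andbT.
by rewrite (big_pred1 (U t)) // => u; rewrite /= eq_sym.
Qed.

Lemma pr_predC (E : pred T) : pr p [pred t | ~~ E t] = \sum_t p t - pr p E.
Proof. by rewrite /pr [X in _ = X - _](bigID E) /= [RHS]addrC addKr. Qed.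

End FiniteProbabilityTheory.

(* Gibbs' inequality: [Q v] is a guess at the law of [U] given [V = v]. *)
Lemma mutual_info_ge (R : realType) (b : R) (T A B : finType) (p : T -> R)
    (U : T -> A) (V : T -> B) (Q : B -> A -> R) :
  1 < b -> is_distribution p ->
  (forall v u, 0 < Q v u) -> (forall v, \sum_u Q v u <= 1) ->
  \sum_t p t * logb b (Q (V t) (U t) / pr p [pred s | U s == U t])
    <= mutual_info b p U V.
Proof.
move=> b1 [p0 p1] Q0 Q1; have lb := ln_gt0 b1.
pose puv u v := pr p [pred t | (U t == u) && (V t == v)].
pose pu u := pr p [pred t | U t == u].
pose pv v := pr p [pred t | V t == v].
have sum_v (G : A -> B -> R) :
    \sum_u \sum_v puv u v * G u v = \sum_t p t * G (U t) (V t).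
  rewrite exchange_big /=.
  under eq_bigr => v _ do rewrite (sum_pr _ _ (fun t => V t == v)).
  rewrite (exchange_big_dep xpredT) //=; apply: eq_bigr => t _.
  by rewrite (big_pred1 (V t)) // => v; rewrite /= eq_sym.
rewrite -(sum_v (fun u v => logb b (Q v u / pu u))) -subr_ge0 /mutual_info.
rewrite -sumrB.
under eq_bigr do rewrite -sumrB.
(* Termwise [ln z <= z - 1] leaves this double sum, which is nonnegative: [puv] has total mass 1,
   and [pv v * Q v u] has total mass at most 1. *)
apply: (@le_trans _ _ (\sum_u \sum_v (puv u v - pv v * Q v u) / ln b)).
  under eq_bigr do rewrite -mulr_suml sumrB.
  rewrite -mulr_suml; apply: divr_ge0; last exact: ltW.
  rewrite sumrB subr_ge0.
  have -> : \sum_u \sum_v puv u v = 1.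
    under eq_bigr do under eq_bigr do rewrite -[puv _ _]mulr1.
    by rewrite (sum_v (fun _ _ => 1)); under eq_bigr do rewrite mulr1.
  have <- : \sum_v pv v = 1.
    under eq_bigr => v _.
      rewrite (_ : pv v = pr p [pred t | (V t == v) && xpredT t] * 1); first over.
      by rewrite mulr1; apply: eq_bigl => t; rewrite /= andbT.
    by rewrite (sum_pr _ _ xpredT); under eq_bigr do rewrite mulr1.
  rewrite exchange_big; apply: ler_sum => v _; rewrite -mulr_sumr.
  by apply: ler_piMr => //; exact: pr_ge0.
apply: ler_sum => u _; apply: ler_sum => v _.
rewrite -/(puv u v) -/(pu u) -/(pv v).
(* On a null cell the logarithmic terms vanish through their factor [puv u v], and the bound is
   nonpositive. On the others both marginals are positive, so the logarithms split and [pu u]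
   cancels. *)
have [z|nz] := eqVneq (puv u v) 0.
  rewrite z !mul0r subrr sub0r mulNr oppr_le0 divr_ge0 ?(ltW lb)//.
  by rewrite mulr_ge0 ?pr_ge0 ?ltW.
have puv0 : 0 < puv u v by rewrite lt_def nz pr_ge0.
have pu0 : 0 < pu u.
  by apply: lt_le_trans puv0 _; apply: pr_le => // t /andP[].
have pv0 : 0 < pv v.
  by apply: lt_le_trans puv0 _; apply: pr_le => // t /andP[].
rewrite -mulrBr /logb -mulrBl mulrA ler_pM2r ?invr_gt0//.
have Q0' := Q0 v u.
have r0 : 0 < pv v * Q v u / puv u v by rewrite divr_gt0 ?mulr_gt0.
have -> : ln (puv u v / (pu u * pv v)) - ln (Q v u / pu u)
    = - ln (pv v * Q v u / puv u v).
  by rewrite !ln_div ?lnM ?posrE ?mulr_gt0//; lra.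
have : ln (pv v * Q v u / puv u v) <= pv v * Q v u / puv u v - 1.
  have := @le_ln1Dx R (pv v * Q v u / puv u v - 1).
  by rewrite [1 + _]addrC subrK; apply; lra.
move=> h; rewrite mulrN lerNr opprB.
have -> : pv v * Q v u - puv u v = puv u v * (pv v * Q v u / puv u v - 1).
  by field.
by rewrite ler_pM2l.
Qed.

(* [Q v] is the equal mixture of the uniform law on the candidates for [g]
   compatible with [V = v] and the uniform law on all of [A]. *)
Lemma mutual_info_list_decoding (R : realType) (b : R) (T A B : finType)
    (p : T -> R) (U g : T -> A) (V : T -> B) (L : nat) :
  1 < b -> is_distribution p -> (0 < #|A|)%N -> (0 < L)%N ->
  (forall u, pr p [pred t | U t == u] = #|A|%:R^-1) ->
  (forall v, #|[set g t | t in [pred t | V t == v]]%SET| <= L)%N ->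
  pr p [pred t | g t == U t] * (logb b #|A|%:R - logb b L%:R) - logb b 2
    <= mutual_info b p U V.
Proof.
move=> b1 pd A0 L0 pU cardL; have [p0 p1] := pd; have lb := ln_gt0 b1.
pose S v := [set g t | t in [pred t | V t == v]]%SET.
pose Q v u : R := (u \in S v)%:R / (2 * L%:R) + 1 / (2 * #|A|%:R).
have A0' : 0 < #|A|%:R :> R by rewrite ltr0n.
have L0' : 0 < L%:R :> R by rewrite ltr0n.
have Q0 v u : 0 < Q v u.
  by apply: ltr_wpDl; [apply: divr_ge0 => //; lra | apply: divr_gt0 => //; lra].
(* Each half of the mixture has mass at most 1/2; the first falls short when [S v] has fewer than
   [L] elements. *)
have Q1 v : \sum_u Q v u <= 1.
  rewrite big_split /= -mulr_suml sumr_const -(natr_sum _ _ xpredT).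
  rewrite -big_mkcond sum1_card.
  have h : #|S v|%:R <= L%:R :> R by rewrite ler_nat cardL.
  have h1 : #|S v|%:R / (2 * L%:R) <= 1 / 2 :> R.
    by rewrite ler_pdivrMr ?mulr_gt0//; lra.
  have -> : 1 / (2 * #|A|%:R) *+ #|A| = 1 / 2 :> R.
    by rewrite -mulr_natr; field; rewrite gt_eqF.
  lra.
apply: le_trans _ (mutual_info_ge U V b1 pd Q0 Q1).
have -> : logb b 2 = \sum_t p t * logb b 2 by rewrite -mulr_suml p1 mul1r.
rewrite [X in X * _]/pr mulr_suml big_mkcond -sumrB; apply: ler_sum => t _.
rewrite pU invrK.
have key (x y : R) : 0 < x -> x <= y -> logb b x <= logb b y.
  move=> x0 xy; rewrite ler_pM2r ?invr_gt0// ler_ln ?posrE//.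
  exact: lt_le_trans xy.
(* If [g t] is the true message, then [U t] lies in [S (V t)] and the first half of [Q] alone gives
   the ratio [#|A| / (2 L)]. Otherwise the second half still gives 1/2, so the loss never exceeds
   [logb b 2]. *)
case: ifPn => [/eqP gU|_].
  rewrite -mulrBr; apply: ler_wpM2l => //.
  have -> : logb b #|A|%:R - logb b L%:R - logb b 2 = logb b (#|A|%:R / (2 * L%:R)).
    by rewrite /logb ln_div ?lnM ?posrE ?mulr_gt0//; lra.
  apply: key; first by rewrite divr_gt0 ?mulr_gt0.
  rewrite /Q; have -> : U t \in S (V t) by rewrite -gU; apply: imset_f; rewrite inE.
  have -> : (true%:R / (2 * L%:R) + 1 / (2 * #|A|%:R)) * #|A|%:R
      = #|A|%:R / (2 * L%:R) + 2^-1 :> R by rewrite [true%:R]mulr1n; field; rewrite !gt_eqF.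
  by rewrite lerDl.
rewrite sub0r -mulrN; apply: ler_wpM2l => //.
have -> : - logb b 2 = logb b 2^-1 by rewrite /logb lnV ?posrE// mulNr.
apply: key => //; rewrite /Q.
set z := _ / _.
have -> : (z + 1 / (2 * #|A|%:R)) * #|A|%:R = z * #|A|%:R + 2^-1 :> R.
  by field; rewrite gt_eqF.
by rewrite lerDr mulr_ge0 ?divr_ge0 ?mulr_ge0 ?ler0n.
Qed.

(** * Counting the inputs compatible with Eve's output *)

Lemma card_mulmx_fiber (F : finFieldType) (m n : nat) (A : 'M[F]_(m, n))
    (y : 'cV[F]_m) :
  (#|[pred x : 'cV[F]_n | A *m x == y]| <= #|F| ^ (n - \rank A))%N.
Proof.
have [x0 /eqP hx0|h] := pickP [pred x : 'cV[F]_n | A *m x == y]; last first.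
  by rewrite eq_card0.
(* Subtracting the base point [x0] injects the fibre into the kernel of [A]; the transpose is there
   because [kermx] is a kernel of row vectors. *)
pose f (x : 'cV[F]_n) := (x - x0)^T.
have fI : injective f by move=> x1 x2 /trmx_inj /addIr.
rewrite -mxrank_tr -mxrank_ker -card_rowg -(card_imset _ fI).
apply/subset_leq_card/fintype.subsetP => _ /imsetP[x /eqP hx ->].
rewrite mem_rowg; apply/sub_kermxP.
by rewrite -trmx_mul mulmxBr hx hx0 subrr trmx0.
Qed.

Lemma card_channel_fiber (F : finFieldType) (m n N : nat) (A : 'M[F]_(m, n))
    (y : block F m N) :
  (#|[pred x : block F n N | channel_output A x == y]|
    <= #|F| ^ ((n - \rank A) * N))%N.
Proof.
(* The channel is memoryless, so the fibre is a product of one-letter fibres. *)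
rewrite (eq_card (B := family (fun i => [pred x | A *m x == y i]))); last first.
  move=> x; rewrite !inE; apply/eqP/familyP => [<- i|h].
    by rewrite inE ffunE.
  by apply/ffunP => i; rewrite ffunE; apply/eqP; have := h i; rewrite inE.
rewrite card_family foldrE big_map expnM -[N in (_ ^ N)%N]card_ord -prod_nat_const.
rewrite -big_enum; apply: leq_prod => i _; exact: card_mulmx_fiber.
Qed.

(** * The joint law of a code and the one-shot converse *)

Lemma joint_law_distribution (R : realType) (F : finFieldType) (n K N : nat)
    (c : wiretap_code R F n K N) :
  (0 < K)%N -> is_distribution (joint_law c).
Proof.
move=> K0; split=> [t|].
  by rewrite mulr_ge0 ?invr_ge0 ?ler0n// (encoder_distribution c t.1).1.
rewrite -(pair_bigA _ (fun w x => K%:R^-1 * encoder c w x)) /=.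
under eq_bigr do rewrite -mulr_sumr (encoder_distribution c _).2 mulr1.
by rewrite sumr_const card_ord -[LHS]mulr_natr mulVf// pnatr_eq0 -lt0n.
Qed.

Lemma joint_law_message (R : realType) (F : finFieldType) (n K N : nat)
    (c : wiretap_code R F n K N) (w : 'I_K) :
  pr (joint_law c) [pred t | t.1 == w] = K%:R^-1.
Proof.
have -> : pr (joint_law c) [pred t | t.1 == w]
    = \sum_(i | i == w) \sum_x K%:R^-1 * encoder c i x.
  by rewrite pair_big_dep; apply: eq_bigl => t; rewrite /= andbT.
by rewrite big_pred1_eq -mulr_sumr (encoder_distribution c w).2 mulr1.
Qed.

(** List decoding applied to Bob's estimate, a function of the input block alone: Eve's output
    confines the block to a fibre, so there are at most as many candidate estimates as points in
    that fibre. *)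
Lemma leakage_ge (R : realType) (b : R) (F : finFieldType) (n K N mE : nat)
    (c : wiretap_code R F n K N) (AB : 'M[F]_n) (AE : 'M[F]_(mE, n)) :
  1 < b -> (0 < K)%N ->
  (1 - error_prob c AB) *
    (logb b K%:R - N%:R * ((n%:R - (\rank AE)%:R) * logb b #|F|%:R)) - logb b 2
    <= leakage c b AE.
Proof.
move=> b1 K0.
have F0 : (0 < #|F|)%N by apply/card_gt0P; exists 0.
have := @mutual_info_list_decoding R b _ _ _ (joint_law c) (fun t => t.1)
  (fun t => decoder c (channel_output AB t.2))
  (fun t => channel_output AE t.2) (#|F| ^ ((n - \rank AE) * N)) b1
  (joint_law_distribution _ K0).
rewrite card_ord expn_gt0 F0 => /(_ K0 isT (joint_law_message _)) h.
apply: le_trans _ (h _) => [|v].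
  rewrite /error_prob pr_predC (joint_law_distribution c K0).2 subKr.
  have -> : logb b (#|F| ^ ((n - \rank AE) * N))%N%:R
    = N%:R * ((n%:R - (\rank AE)%:R) * logb b #|F|%:R) :> R.
    rewrite /logb natrX lnXn ?ltr0n// -natrB ?rank_leq_col// -[X in X / _]mulr_natl.
    by rewrite natrM; ring.
  exact: lexx.
apply: leq_trans _ (card_channel_fiber AE v).
apply: leq_trans _ (leq_imset_card (fun x => decoder c (channel_output AB x)) _).
apply/subset_leq_card/fintype.subsetP => _ /imsetP[t tv ->].
by apply/imsetP; exists t.2.
Qed.

(** * Rounding of the message count, and limits *)

Lemma message_count_bounds (R : realType) (b rate : R) (N : nat) :
  1 < b -> 0 <= rate ->
  (0 < message_count b rate N)%N /\
  N%:R * rate - logb b 2 <= logb b (message_count b rate N)%:R.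
Proof.
move=> b1 r0; have lb := ln_gt0 b1; rewrite /message_count.
set x := b `^ (N%:R * rate).
have x1 : 1 <= x.
  rewrite /x -[leLHS](powRr0 b); apply: ler_powR; first exact: ltW.
  by rewrite mulr_ge0.
have K0 : (0 < Num.truncn x)%N by rewrite truncn_ge_nat// (le_trans ler01).
split=> //.
(* Since the floor [K] of [x] is at least 1, [x < K + 1 <= 2 K]: rounding costs at most
   [logb b 2]. *)
have K1 : 1 <= (Num.truncn x)%:R :> R by rewrite ler1n.
have /andP[_] := truncn_itv (le_trans ler01 x1); rewrite -natr1 => xK.
rewrite -(@ler_pM2r _ (ln b))// mulrBl /logb !divfK ?gt_eqF//.
rewrite -ln_powR -/x -ln_div ?posrE//; last by rewrite (lt_le_trans ltr01).
by rewrite ler_ln ?posrE; lra.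
Qed.

(** For each [e > 0] some tail of [u] stays above [l - e], hence so does its infimum; the limit
    inferior is the supremum of these tail infima. *)
Lemma le_limn_einf (R : realType) (u v : R^nat) (l : R) :
  v @ \oo --> l -> (\forall N \near \oo, v N <= u N) ->
  (l%:E <= limn_einf (fun N => (u N)%:E))%E.
Proof.
move=> vl vu; apply/lee_subgt0Pr => e e0.
have lev : \forall N \near \oo, l - e <= u N.
  have : \forall N \near \oo, l - e <= v N.
    by apply: cvgr_ge vl _ _; rewrite ltrBlDr ltrDl.
  by move: vu; apply: filterS2 => N h1 h2; exact: le_trans h1.
have [N0 _ hN0] := lev.
rewrite limn_einf_lim.
rewrite (cvg_lim _ (@cvg_einfs_sup _ (fun N => (u N)%:E)))//.
apply: (@le_trans _ _ (einfs (fun N => (u N)%:E) N0)).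
  apply: le_ereal_inf_tmp => _ [N /= N0N <-].
  by rewrite -EFinB lee_fin; exact: hN0.
by apply: ereal_sup_ubound; exists N0.
Qed.

Lemma cvg_divn0 (R : realType) (c : R) : c / N%:R @[N --> \oo] --> (0 : R).
Proof.
rewrite -[X in _ --> X](mulr0 c); apply: cvgMl_tmp.
apply/gtr0_cvgV0; first by near=> N; rewrite ltr0n; near: N; exact: nbhs_infty_gt.
exact: cvgr_idn.
Unshelve. all: by end_near. Qed.

Theorem theorem3p14 (R : realType) (b : R) (hb : 1 < b)
    (F : finFieldType) (q : nat) (hq : #|F| = q)
    (n : nat) (hn : (1 <= n)%N)
    (AB : 'M[F]_n) (hAB : AB \in unitmx)
    (mE rE : nat) (AE : 'M[F]_(mE, n))
    (hrank : \rank AE = rE) (hrE : (rE <= mE)%N) (hmE : (mE < n)%N)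
    (Cs : R) (hCs : Cs = (n%:R - rE%:R) * logb b q%:R)
    (rate : R) (hrate : Cs < rate)
    (code : forall N : nat, wiretap_code R F n (message_count b rate N) N) :
  (error_prob (code N) AB @[N --> \oo] --> (0 : R) ->
     ((rate - Cs)%:E <=
        limn_einf (fun N => (leakage (code N) b AE / N%:R)%:E))%E
     /\ 0 < rate - Cs)
  /\
  (leakage (code N) b AE / N%:R @[N --> \oo] --> (0 : R) ->
     ((1 - Cs / rate)%:E <=
        limn_einf (fun N => (error_prob (code N) AB)%:E))%E
     /\ 0 < 1 - Cs / rate).
Proof.
have D0 : 0 < rate - Cs by rewrite subr_gt0.
have Cs0 : 0 <= Cs.
  have q1 : (1 <= q)%N by rewrite -hq; apply/card_gt0P; exists 0.
  have rn : (rE <= n)%N := leq_trans hrE (ltnW hmE).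
  rewrite hCs; apply: mulr_ge0; first by rewrite subr_ge0 ler_nat.
  by apply: divr_ge0; apply: ln_ge0; [rewrite ler1n | exact: ltW].
have rate0 : 0 < rate := le_lt_trans Cs0 hrate.
(* One [logb b 2] pays for the mixture in the list-decoding bound, the other for the floor in the
   message count. *)
pose c := logb b 2 + logb b 2 : R.
have main : \forall N \near \oo,
    (1 - error_prob (code N) AB) * (rate - Cs) - c / N%:R
      <= leakage (code N) b AE / N%:R.
  near=> N.
  have N0 : 0 < N%:R :> R by rewrite ltr0n; near: N; exact: nbhs_infty_gt.
  have [K0 hK] := message_count_bounds N hb (ltW rate0).
  have := leakage_ge (code N) AB AE hb K0.
  rewrite hrank hq -hCs => hI.
  have [p0 p1] := joint_law_distribution (code N) K0.
  have e0 : 0 <= error_prob (code N) AB by exact: pr_ge0.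
  have e1 : 0 <= 1 - error_prob (code N) AB.
    rewrite subr_ge0 -p1; apply: le_trans (@pr_le _ _ _ p0 _ xpredT _) _ => //.
  rewrite ler_pdivlMr// mulrBl divfK ?gt_eqF//.
  apply: le_trans _ hI; rewrite /c opprD addrA lerD2r.
  (* The floor loss enters multiplied by one minus the error probability, a factor of at most 1. *)
  have l2 : 0 <= logb b 2 :> R by apply: divr_ge0; apply: ln_ge0; [rewrite ler1n | exact: ltW].
  have := ler_wpM2l e1 hK.
  nra.
split=> [he|hI].
  split=> //; apply: le_limn_einf main.
  rewrite -[X in _ --> X]subr0; apply: cvgB; last exact: cvg_divn0.
  rewrite -[X in _ --> X]mul1r; apply: cvgMr_tmp.
  by rewrite -[X in _ --> X]subr0; apply: cvgB => //; exact: cvg_cst.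
have r1 : Cs / rate < 1 by rewrite ltr_pdivrMr// mul1r.
split; last by rewrite subr_gt0.
apply: (@le_trans _ _ (1%:E)).
  by rewrite lee_fin gerBl divr_ge0// ltW.
(* This is [main] solved for the error probability; the minorant tends to 1 as the leakage rate and
   [c / N] vanish. *)
apply: (@le_limn_einf _ _ (fun N =>
  1 - (leakage (code N) b AE / N%:R + c / N%:R) / (rate - Cs))).
  rewrite -[X in _ --> X]subr0; apply: cvgB; first exact: cvg_cst.
  rewrite -[X in _ --> X](mul0r (rate - Cs)^-1); apply: cvgMr_tmp.
  by rewrite -[X in _ --> X]addr0; apply: cvgD => //; exact: cvg_divn0.
move: main; apply: filterS => N h.
by rewrite lerBlDr -lerBlDl ler_pdivlMr//; lra.
Unshelve. all: by end_near. Qed.
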